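(* Let $f(\theta)=\sum_{k=0}^{\infty}a_k\theta^k$ be a power series with $a_k>0$ for all $k\ge 0$ and positive radius of convergence $R_1\in(0,\infty]$. Assume that $\{b_k:k\ge 0\}$ is an unbounded sequence of real numbers such that $b_0=1$, $b_k\ge 1$ for all $k\ge 1$, the set $J:=\{k\ge 0:b_k=1\}$ is finite, and the power series $h(\theta):=\sum_{k=0}^{\infty}b_k^2a_k\theta^k$ has positive radius of convergence $R_2\in(0,\infty]$. Let $R:=\min(R_1,R_2)$ (possibly $R=+\infty$), and define $g(\theta):=\sum_{k=0}^{\infty}b_ka_k\theta^k$ for $\theta\in(0,R)$. Consider the family $\mathcal P_{f,g}=\{P_\theta:\theta\in(0,R)\}$ of discrete distributions on $\{-1,0,1,2,\ldots\}$, where $P_\theta$ has probability mass function $$p(k;\theta)=\begin{cases}1-f(\theta)/g(\theta) & \text{if } k=-1,\\ a_k\theta^k/g(\theta) & \text{if } k=0,1,2,\ldots.\end{cases}$$ Suppose $X$ has probability mass function $p(\cdot;\theta)$, $\theta\in(0,R)$. Then the following hold. (a) For a function $\delta:\{-1,0,1,2,\ldots\}\to\mathbb R$, $\delta(X)$ is an unbiased estimator of zero with finite variance if and only if $$\delta(k)=-\delta(-1)\,(b_k-1)\quad\text{for } k=0,1,2,\ldots.$$ (b) $\mathcal P_{f,g}$ is not complete but is boundedly complete. (c) A parametric function $\psi:(0,R)\to\mathbb R$ has a UMVUE with finite variance if and only if there exist real numbers $a$ and $c_k$ ($k\in J$) such that $\psi(\theta)=a+\sum_{k\in J}c_k\theta^k/g(\theta)$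 for all $\theta\in(0,R)$.
   Context: $\mathrm E_\theta$ denotes expectation when $X\sim P_\theta$. An estimator is $T(X)$ for a function $T:\{-1,0,1,2,\ldots\}\to\mathbb R$. ''Unbiased estimator of zero with finite variance'' means $\mathrm E_\theta(\delta(X)^2)<\infty$ and $\mathrm E_\theta(\delta(X))=0$ for all $\theta\in(0,R)$. The family is complete if, for every $\delta$ such that $\mathrm E_\theta(\delta(X))$ exists and equals $0$ for all $\theta\in(0,R)$, one has $P_\theta(\delta(X)=0)=1$ for all $\theta\in(0,R)$. It is boundedly complete if this implication holds for every bounded $\delta$. A UMVUE (uniformly minimum variance unbiased estimator) with finite variance of $\psi$ is an estimator $T(X)$ with $\mathrm E_\theta(T(X)^2)<\infty$ and $\mathrm E_\theta(T(X))=\psi(\theta)$ for all $\theta\in(0,R)$, such that for every estimator $S(X)$ with $\mathrm E_\theta(S(X))=\psi(\theta)$ for all $\theta\in(0,R)$, one has $\mathrm{Var}_\theta(T(X))\le\mathrm{Var}_\theta(S(X))$ for all $\theta\in(0,R)$ (the right-hand side may be $+\infty$). The series defining $g$ converges on $(0,R)$ and $0<f(\theta)<g(\theta)$ there, so that $p(\cdot;\theta)$ is a well-defined probability mass function. *)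

(* Defs.v *)
From HB Require Import structures.
From mathcomp Require Import all_boot all_order all_algebra.
From mathcomp Require Import all_classical all_reals all_analysis.

Set Implicit Arguments.
Unset Strict Implicit.
Unset Printing Implicit Defensive.

Import Order.TTheory GRing.Theory Num.Theory.
Import numFieldNormedType.Exports.

Local Open Scope classical_set_scope.
Local Open Scope ring_scope.

(* The sample space {-1, 0, 1, 2, ...} with the discrete sigma-algebra:
   [None] stands for -1 and [Some k] for the natural number k. Since every
   subset is measurable, every function on it is a random variable. *)
Definition outcome : Type := option nat.

HB.instance Definition _ := Pointed.on outcome.
HB.instance Definition _ := @isMeasurable.Build default_measure_display
  outcome discrete_measurable discrete_measurable0
  discrete_measurableC discrete_measurableU.

Definition is_pmf (R : realType) (p : outcome -> R) : Prop :=
  (forall x, 0 <= p x) /\ (\esum_(x in [set: outcome]) (p x)%:E = 1)%E.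

(* The probability measure with mass function [p]. The Dirac mass is a default
   value, used only when [p] is not a probability mass function. *)
Definition pmf_prob (R : realType) (p : outcome -> R) :
    set outcome -> \bar R :=
  fun A => if `[< is_pmf p >] then (\esum_(x in A) (p x)%:E)%E
           else \d_(None : outcome) A.

Section pmf_prob.
Context (R : realType) (p : outcome -> R).
Local Open Scope ereal_scope.

Let pmf_prob0 : pmf_prob p set0 = 0.
Proof. by rewrite /pmf_prob measure0 esum_set0 if_same. Qed.

Let pmf_prob_ge0 A : 0 <= pmf_prob p A.
Proof.
rewrite /pmf_prob; case: ifPn => // /asboolP[p0 _].
by apply: esum_ge0 => x _; rewrite lee_fin.
Qed.

Let pmf_prob_sigma_additive : semi_sigma_additive (pmf_prob p).
Proof.
move=> F mF tF mUF; rewrite /pmf_prob; case: ifPn => [/asboolP[p0 _]|_].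
  apply: cvg_toP.
    apply: ereal_nondecreasing_is_cvgn => m n mn.
    apply: lee_sum_nneg_natr => // k _ _.
    by apply: esum_ge0 => x _; rewrite lee_fin.
  by rewrite nneseries_sum_bigcup// => x; rewrite lee_fin.
exact: measure_semi_sigma_additive.
Qed.

HB.instance Definition _ := isMeasure.Build _ _ _ (pmf_prob p)
  pmf_prob0 pmf_prob_ge0 pmf_prob_sigma_additive.

Let pmf_prob_setT : pmf_prob p [set: outcome] = 1.
Proof.
by rewrite /pmf_prob; case: ifPn => [/asboolP[]//|_]; rewrite probability_setT.
Qed.

HB.instance Definition _ :=
  @Measure_isProbability.Build _ _ R (pmf_prob p) pmf_prob_setT.

End pmf_prob.

Definition radius_of_convergence (R : realType) (a : nat -> R) : \bar R :=
  ereal_sup [set `|x|%:E | x in [set x : R | cvgn (pseries a x)]].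

Definition powser (R : realType) (a : nat -> R) (t : R) : R :=
  limn (pseries a t).

Definition pfg (R : realType) (a b : nat -> R) (t : R) (x : outcome) : R :=
  let f := powser a in let g := powser (fun k => b k * a k) in
  if x is Some k then a k * t ^+ k / g t else 1 - f t / g t.

Definition Pfg (R : realType) (a b : nat -> R) (t : R) :
  probability outcome R := pmf_prob (pfg a b t).

Lemma cvg_pseries_lt_radius (R : realType) (a : nat -> R) (t : R) :
  0 < t -> (t%:E < radius_of_convergence a)%E -> cvgn (pseries a t).
Proof.
move=> t0 /ereal_sup_gt[_ [x cx <-]]; rewrite lte_fin => tx.
by apply: is_cvg_pseries_inside cx _; rewrite gtr0_norm.
Qed.

(* On (0, R) the default value of [pmf_prob] is never used. *)
Lemma pfg_is_pmf (R : realType) (a b : nat -> R) (t : R) :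
  (forall k, 0 < a k) -> (forall k, 1 <= b k) -> 0 < t ->
  (t%:E < radius_of_convergence a)%E ->
  (t%:E < radius_of_convergence (fun k => (b k ^+ 2 * a k)%R))%E ->
  is_pmf (pfg a b t).
Proof.
move=> a0 b1 t0 tR1 tR2.
have cf := cvg_pseries_lt_radius t0 tR1.
have at0 k : 0 < a k * t ^+ k by rewrite mulr_gt0// exprn_gt0.
have b0 k : 0 <= b k by rewrite (le_trans _ (b1 k)).
have cg : cvgn (pseries (fun k => b k * a k) t).
  apply: series_le_cvg (cvg_pseries_lt_radius t0 tR2) => k /=.
  - by rewrite -mulrA mulr_ge0// ltW.
  - by rewrite -mulrA mulr_ge0// ?exprn_ge0// ltW.
  - rewrite -[leLHS]mulrA -[leRHS]mulrA ler_pM2r// expr2 ler_peMl//.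
have f0 : 0 < powser a t.
  apply: (@lt_le_trans _ _ (pseries a t 1)).
    by rewrite /pseries/= seriesEnat/= big_nat1.
  apply: (nondecreasing_cvgn_le _ cf).
  by apply: nondecreasing_series => k _ _; exact: ltW (at0 k).
have fg : powser a t <= powser (fun k => b k * a k) t.
  apply: (lim_series_le cf cg) => k /=.
  by rewrite -mulrA ler_peMl// ltW.
have g0 := lt_le_trans f0 fg.
have p0 x : 0 <= pfg a b t x.
  case: x => [k|] /=; first by rewrite divr_ge0// ltW.
  by rewrite subr_ge0 ler_pdivrMr// mul1r.
split=> //.
rewrite (esumID [set None]); last by move=> x _; rewrite lee_fin.
rewrite setTI esum_set1 ?lee_fin//.
rewrite (_ : [set: outcome] `&` ~` [set None] = Some @` [set: nat]); last first.
  by apply/seteqP; split=> [[k|] []//= _ _|_ [k _ <-]//]; exists k.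
rewrite esum_image; last by move=> ? ? _ _ [].
rewrite -nneseries_esumT/=; last by move=> k; rewrite lee_fin (p0 (Some k)).
rewrite -[X in (_ + X)%E](_ : (powser a t / powser (fun k => b k * a k) t)%:E = _).
  by rewrite -EFinD subrK.
apply/esym/cvg_lim => //.
rewrite [X in X @ _](_ : _ =
    EFin \o (fun n => pseries a t n / powser (fun k => b k * a k) t)); last first.
  by apply/funext => n /=; rewrite /pseries/= /series/= mulr_suml sumEFin.
by apply: cvg_EFin; [exact: nearW|apply: cvgMl].
Qed.

Lemma Pfg1 (R : realType) (a b : nat -> R) (t : R) :
  (forall k, 0 < a k) -> (forall k, 1 <= b k) -> 0 < t ->
  (t%:E < radius_of_convergence a)%E ->
  (t%:E < radius_of_convergence (fun k => (b k ^+ 2 * a k)%R))%E ->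
  forall x, Pfg a b t [set x] = (pfg a b t x)%:E.
Proof.
move=> a0 b1 t0 tR1 tR2 x; have pmf := pfg_is_pmf a0 b1 t0 tR1 tR2.
rewrite /Pfg /= /pmf_prob asboolT// esum_set1// lee_fin.
by case: pmf.
Qed.

Section families.
Context (R : realType).
Implicit Types (D : set R) (P : R -> probability outcome R) (psi : R -> R).
Implicit Types (T : outcome -> R).

Definition unbiased D P psi T : Prop :=
  forall t, D t -> (P t).-integrable [set: outcome] (EFin \o T) /\
                   ('E_(P t)[T] = (psi t)%:E)%E.

Definition finite_second_moment D P T : Prop :=
  forall t, D t -> ('E_(P t)[fun x => (T x ^+ 2)%R] < +oo)%E.

Definition complete D P : Prop :=
  forall delta : outcome -> R, unbiased D P (fun=> 0) delta ->
  forall t, D t -> P t [set x | delta x = 0] = 1%E.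

Definition boundedly_complete D P : Prop :=
  forall delta : outcome -> R, bounded_fun delta ->
  unbiased D P (fun=> 0) delta ->
  forall t, D t -> P t [set x | delta x = 0] = 1%E.

Definition UMVUE_finite_variance D P psi T : Prop :=
  [/\ finite_second_moment D P T, unbiased D P psi T &
      forall S : outcome -> R, unbiased D P psi S ->
      forall t, D t -> ('V_(P t)[T] <= 'V_(P t)[S])%E].

End families.

(* Main.v *)
(* Since g = sum_k b_k a_k t^k and the probabilities add up to 1,
   E_t X = X(-1) + (1/g(t)) sum_k (X(k) - X(-1)) a_k t^k, so E_t X = 0 on (0, R)
   says that the power series with coefficients (X(k) - X(-1) + X(-1) b_k) a_k
   vanishes near 0; uniqueness of coefficients determines the unbiased
   estimators of zero even without the finite variance assumption, and an
   unbounded b leaves no bounded one but 0. A UMVUE T is uncorrelated with such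
   an estimator X, that is, T X is again an unbiased estimator of zero; applying
   uniqueness a second time gives (b_k - 1) (T(k) - T(-1)) = 0. *)
Require Import Defs.
From mathcomp Require Import all_boot all_order all_algebra.
From mathcomp Require Import all_classical all_reals all_analysis.
From mathcomp Require Import ring lra.

Set Implicit Arguments.
Unset Strict Implicit.
Unset Printing Implicit Defensive.

Import Order.TTheory GRing.Theory Num.Theory.
Import numFieldNormedType.Exports.

Local Open Scope classical_set_scope.
Local Open Scope ring_scope.

(** * Integration over the discrete sample space *)

Lemma measurable_outcome d (T : measurableType d) (X : outcome -> T) :
  measurable_fun setT X.
Proof. by []. Qed.

Lemma bigcup_Some (T : Type) :
  \bigcup_(k in [set: T]) [set Some k] = ~` [set None].
Proof. by apply/seteqP; split=> [_ [k _ ->]//|[k _|[]//]]; exists k. Qed.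

Section discrete_expectation.
Context (R : realType) (P : probability outcome R).
Implicit Type X : outcome -> R.
Let p k := fine (P [set Some k]).

Let pE k : P [set Some k] = (p k)%:E.
Proof. by rewrite /p fineK// fin_num_measure. Qed.

Let p_ge0 k : 0 <= p k.
Proof. exact: fine_ge0. Qed.

Let integral_Some (f : outcome -> \bar R) k :
  (\int[P]_(x in [set Some k]) f x = f (Some k) * (p k)%:E)%E.
Proof.
rewrite -pE (eq_integral (cst (f (Some k)))) ?integral_cst//.
by move=> x; rewrite inE => ->.
Qed.

Let integral_outcome_restrict (f : outcome -> \bar R) : f None = 0%E ->
  (\int[P]_x f x = \int[P]_(x in \bigcup_k [set Some k]) f x)%E.
Proof.
move=> f0; rewrite [RHS]integral_mkcond; apply: eq_integral => x _.
rewrite patchE bigcup_Some; case: ifPn => //.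
by rewrite notin_setE /= => /contrapT ->.
Qed.

Let trivIset_Some : trivIset setT (fun k : nat => [set Some k] : set outcome).
Proof. by move=> i j _ _ [_ [-> []]]. Qed.

Lemma ge0_integral_outcome (f : outcome -> \bar R) :
  (forall x, 0 <= f x)%E -> f None = 0%E ->
  (\int[P]_x f x = \sum_(k <oo) f (Some k) * (p k)%:E)%E.
Proof.
move=> f0 fN; rewrite integral_outcome_restrict// ge0_integral_bigcup//.
by apply: eq_eseriesr => k _.
Qed.

Lemma integral_outcome (f : outcome -> \bar R) :
  P.-integrable setT f -> f None = 0%E ->
  (\int[P]_x f x = \sum_(k <oo) f (Some k) * (p k)%:E)%E.
Proof.
move=> f0 fN; rewrite integral_outcome_restrict// integral_bigcup//.
  by apply: eq_eseriesr => k _.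
by apply: integrableS f0.
Qed.

Lemma integrable_outcome_cst_sub X c : P.-integrable setT (EFin \o X) <->
  P.-integrable setT (EFin \o (fun x => X x - c)).
Proof.
have c1 : cst c \in Lfun P 1 := Lfun_cst P c 1.
rewrite -!Lfun1_integrable; split=> X1; first exact: rpredB X1 c1.
suff -> : X = (fun x => X x - c) + cst c by exact: rpredD X1 c1.
by apply/funext => x; rewrite addrfctE subrK.
Qed.

(** Subtracting the constant [X None] removes the atom at -1, so that only a series over the
    naturals remains and the mass at -1 never has to be computed. *)
Lemma integrable_outcomeP X : P.-integrable setT (EFin \o X) <->
  cvgn [normed series (fun k => (X (Some k) - X None) * p k)].
Proof.
rewrite (integrable_outcome_cst_sub X (X None)).
set Y := fun x => X x - X None; set u := [sequence (Y (Some k) * p k)%R]_k.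
have YE : (\int[P]_x `|(Y x)%:E| = \sum_(k <oo) `|u k|%:E)%E.
  rewrite ge0_integral_outcome//; last by rewrite /Y subrr abse0.
  by apply: eq_eseriesr => k _; rewrite -EFinM normrM (ger0_norm (p_ge0 k)).
split=> [/integrableP[_]|cu].
  rewrite [X in (X < _)%E]YE => loo.
  apply: nondecreasing_is_cvgn.
    by apply: nondecreasing_series => k _ _; exact: normr_ge0.
  exists (fine (\sum_(k <oo) `|u k|%:E)%E) => _ [n _ <-].
  rewrite -lee_fin fineK; last first.
    by rewrite ge0_fin_numE// nneseries_ge0.
  rewrite -sumEFin; apply: nneseries_lim_ge => k _ _.
  by rewrite lee_fin normr_ge0.
apply/integrableP; split=> //; rewrite [X in (X < _)%E]YE.
rewrite (_ : (fun n => _) = EFin \o [normed series u]); last first.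
  by apply/funext => n /=; rewrite sumEFin.
by rewrite EFin_lim// ltry.
Qed.

Lemma expectation_outcome X : P.-integrable setT (EFin \o X) ->
  'E_P[X]%E =
  (X None + limn (series (fun k => (X (Some k) - X None) * p k)))%:E.
Proof.
move=> iX; have /integrable_outcomeP/normed_cvg cu := iX.
have iY := (integrable_outcome_cst_sub X (X None)).1 iX.
pose Y := X \- cst (X None).
have -> : ('E_P[X] = (X None)%:E + 'E_P[Y])%E.
  rewrite expectationB//; last exact/Lfun_cst; last exact/Lfun1_integrable.
  by rewrite expectation_cst [RHS]addeC subeK.
rewrite unlock integral_outcome//; last by rewrite /Y /= subrr.
rewrite EFinD -(EFin_lim cu); congr (_ + limn _)%E.
by apply/funext => n /=; rewrite -sumEFin.
Qed.

End discrete_expectation.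

(** * Uniqueness of power series coefficients *)

(** Strong induction: once the coefficients below [k] vanish, the zero sum at [s * r] makes the
    [k]-th term the negative of the tail, which is at most [s ^+ k.+1 * M]. Cancelling [s ^+ k]
    bounds |c_k| r^k by [s * M] for every [s] in (0, 1], and a small [s] forces [c k = 0]. *)
Lemma powser_eq0 (R : realType) (c : nat -> R) (r : R) : 0 < r ->
  (forall t, 0 < t <= r ->
    cvgn [normed series (fun k => c k * t ^+ k)] /\ powser c t = 0) ->
  forall k, c k = 0.
Proof.
move=> r0 cP; elim/ltn_ind => k IH.
have [|cM _] := cP r; first by rewrite r0 lexx.
set M := limn [normed series (fun k => c k * r ^+ k)].
have bound s : 0 < s <= 1 -> `|c k| * r ^+ k <= s * M.
  move=> /andP[s0 s1]; have [|ct ct0] := cP (s * r).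
    by rewrite mulr_gt0// ler_piMl// ltW.
  (* Terms below [k] vanish by induction; for [j] above [k], [s ^+ j <= s ^+ k.+1] because
     [s <= 1]. *)
  have rest n : (k < n)%N ->
      `|pseries c (s * r) n - c k * (s * r) ^+ k| <= s ^+ k.+1 * M.
    move=> kn; have kn' : k \in index_iota 0 n by rewrite mem_index_iota.
    rewrite /pseries /series/= (bigD1_seq k)//= ?iota_uniq//.
    rewrite addrAC subrr add0r.
    apply: (le_trans (ler_norm_sum _ _ _)).
    apply: (@le_trans _ _ (s ^+ k.+1 *
        [normed series (fun k => c k * r ^+ k)] n)); last first.
      rewrite ler_wpM2l ?exprn_ge0 ?(ltW s0)//.
      apply: nondecreasing_cvgn_le => //.
      by apply: nondecreasing_series => j _ _; exact: normr_ge0.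
    rewrite /series/= mulr_sumr [leRHS](bigD1_seq k)//= ?iota_uniq//.
    rewrite -[leLHS]add0r lerD ?mulr_ge0 ?exprn_ge0 ?(ltW s0)//.
    apply: ler_sum => j; rewrite neq_ltn => /orP[/IH ->|kj].
      by rewrite !mul0r normr0 mulr0.
    rewrite exprMn mulrCA normrM ler_wpM2r// ger0_norm ?exprn_ge0 ?(ltW s0)//.
    by rewrite ler_wiXn2l// ltW.
  have : `|c k * (s * r) ^+ k| <= s ^+ k.+1 * M.
    have cps : pseries c (s * r) n @[n --> \oo] --> 0.
      by rewrite -ct0; exact: (normed_cvg ct).
    have cl : `|pseries c (s * r) n - c k * (s * r) ^+ k| @[n --> \oo] -->
        `|0 - c k * (s * r) ^+ k|.
      by apply: cvg_norm; apply: cvgB => //; exact: cvg_cst.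
    rewrite -normrN -sub0r -(cvg_lim _ cl)//; apply: limr_le.
      by apply/cvg_ex; eexists; exact: cl.
    by near=> n; apply: rest; near: n; exact: nbhs_infty_gt.
  rewrite exprMn mulrCA exprSr normrM ger0_norm ?exprn_ge0 ?(ltW s0)//.
  rewrite -mulrA ler_pM2l ?exprn_gt0// normrM.
  by rewrite [X in _ * X]ger0_norm// exprn_ge0// ltW.
have [//|ck0] := eqVneq (c k) 0.
have A0 : 0 < `|c k| * r ^+ k by rewrite mulr_gt0 ?normr_gt0 ?exprn_gt0.
set A := `|c k| * r ^+ k in bound A0 *.
have AM : A <= M by rewrite -[leRHS]mul1r bound// ltr01 lexx.
have M0 : 0 < M by exact: lt_le_trans AM.
(* The choice s = A / (2M) is admissible since [A <= M], and it gives A <= A / 2, against [A0]. *)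
have : A <= A / (M *+ 2) * M.
  apply: bound; rewrite divr_gt0 ?mulrn_wgt0//= ler_pdivrMr ?mulrn_wgt0//.
  by rewrite mul1r (le_trans AM)// mulr2n lerDl ltW.
rewrite (_ : A / (M *+ 2) * M = A / 2); last first.
  by field; rewrite gt_eqF.
by lra.
Unshelve. all: by end_near. Qed.

(** * Series with finite support *)

Lemma finite_set_nat_bound (J : set nat) : finite_set J ->
  exists N, J `<=` `I_N.
Proof.
move=> Jfin; exists (\max_(k <- finmap.enum_fset (fset_set J)) k).+1 => k Jk /=.
rewrite ltnS; apply: leq_bigmax_seq => //.
by rewrite in_fset_set//; exact: mem_set.
Qed.

Lemma cvg_series_finite_support (R : realType) (u : nat -> R) (J : set nat) :
  finite_set J -> (forall k, ~ J k -> u k = 0) ->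
  series u @ \oo --> \sum_(k \in J) u k.
Proof.
move=> /finite_set_nat_bound[N JN] u0; apply: cvg_near_cst; near=> n.
rewrite /series/= big_mkord fsbig_ord; apply/esym/fsbig_widen.
  by move=> k /JN /= kN; apply: leq_trans kN _; near: n; exact: nbhs_infty_ge.
by move=> k [_ /u0].
Unshelve. all: by end_near. Qed.

(** * Second moments and covariance *)

Lemma Lfun2_second_moment d (T : measurableType d) (R : realType)
    (P : probability T R) (X : T -> R) :
  measurable_fun setT X -> ('E_P[fun x => (X x ^+ 2)%R] < +oo)%E ->
  X \in Lfun P 2%:E.
Proof.
move=> mX X2; rewrite inE; apply/andP; split; apply: mem_set => //=.
rewrite /finite_norm unlock /=.
apply: poweR_lty; move: X2; rewrite unlock; congr (_ < _)%E.
by apply: eq_integral => x _; rewrite powR_mulrn// real_normK ?num_real.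
Qed.

(** For every real c, T + cX is again unbiased for [psi], so minimality gives 0 <= c^2 Var X + 2c
    Cov(T, X). A quadratic in c without constant term stays nonnegative only if its linear
    coefficient vanishes. *)
Lemma UMVUE_uncorrelated (R : realType) (D : set R)
    (P : R -> probability outcome R) (psi : R -> R) (T X : outcome -> R) t :
  UMVUE_finite_variance D P psi T ->
  unbiased D P (fun=> 0) X -> finite_second_moment D P X -> D t ->
  covariance (P t) T X = 0%E.
Proof.
move=> [T2 uT Tmin] uX X2 Dt.
have LT : T \in Lfun (P t) 2%:E by exact: Lfun2_second_moment (T2 _ Dt).
have LX : X \in Lfun (P t) 2%:E by exact: Lfun2_second_moment (X2 _ Dt).
have Pfin : P t setT \is a fin_num := fin_num_measure (P t) _ measurableT.
have LT1 := Lfun_subset12 Pfin LT; have LX1 := Lfun_subset12 Pfin LX.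
have LTX := Lfun2_mul_Lfun1 LT LX.
have quad c : ('V_(P t)[T] <=
    'V_(P t)[T] + (c ^+ 2)%:E * 'V_(P t)[X] +
    2%:E * (c%:E * covariance (P t) T X))%E.
  have LcX : c \o* X \in Lfun (P t) 2%:E by rewrite Lfun_scale// ler1n.
  rewrite -varianceZ// -covarianceZr// -varianceD//; apply: Tmin => // s Ds.
  have [iT ET] := uT _ Ds; have [iX EX] := uX _ Ds.
  have X1 : X \in Lfun (P s) 1 by exact/Lfun1_integrable.
  have cX1 : c \o* X \in Lfun (P s) 1 by exact: Lfun_scale.
  have T1 : T \in Lfun (P s) 1 by exact/Lfun1_integrable.
  split; first exact/Lfun1_integrable/rpredD.
  by rewrite expectationD// expectationZl// ET EX mule0 adde0.
have := covariance_fin_num LT1 LX1 LTX.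
have := variance_fin_num LX; have := variance_fin_num LT; move: quad.
case: ('V_(P t)[T])%E => [v| |]//; case E : ('V_(P t)[X])%E => [w| |]//.
case: (covariance _ _ _) => [m| |]// quad _ _ _; congr _%:E.
have w0 : 0 <= w by rewrite -lee_fin -E variance_ge0.
have {}quad c : 0 <= c ^+ 2 * w + 2 * (c * m).
  by have := quad c; rewrite -!EFinM -!EFinD lee_fin; lra.
have w1 : 0 < w + 1 by lra.
(* The minimizer would be -m / w; [w + 1] replaces [w] because the variance may be zero. The
   quadratic is then a negative multiple of [m ^+ 2]. *)
have := quad (- m / (w + 1)).
rewrite (_ : _ + _ = - (m ^+ 2 * ((w + 2) / (w + 1) ^+ 2))); last first.
  by field; rewrite gt_eqF.
rewrite oppr_ge0 pmulr_lle0 ?divr_gt0 ?exprn_gt0//; last by lra.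
by move=> h; apply/eqP; rewrite -sqrf_eq0 eq_le sqr_ge0 andbT.
Qed.

(** Used with x = b_k: an unbiased estimator X of zero has X(k)^2 - X(-1)^2 = X(-1)^2 b_k (b_k - 2),
    which is thus dominated by b_k^2. *)
Lemma normM_sub2_le (R : realDomainType) (x : R) : 1 <= x ->
  `|x * (x - 2)| <= x ^+ 2.
Proof. by move=> x1; rewrite ler_norml; apply/andP; split; nra. Qed.

(** * Convergence and expectations in the family *)

Section Pfg_family.
Context (R : realType) (a b : nat -> R).
Hypotheses (a_gt0 : forall k, 0 < a k) (b_ge1 : forall k, 1 <= b k).
Let R1 := radius_of_convergence a.
Let R2 := radius_of_convergence (fun k => b k ^+ 2 * a k).
Let D := [set t : R | 0 < t /\ (t%:E < Order.min R1 R2)%E].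
Let g := powser (fun k => b k * a k).
Let P := Pfg a b.
Implicit Types (t : R) (X : outcome -> R).

(** Provides an interval on which uniqueness of coefficients applies, also when R is infinite. *)
Lemma Pfg_domain_itv : (0 < R1)%E -> (0 < R2)%E ->
  exists2 r, 0 < r & forall t, 0 < t <= r -> D t.
Proof.
move=> R1_gt0 R2_gt0.
have [r r0 rR] : exists2 r, 0 < r & (r%:E < Order.min R1 R2)%E.
  have : (0 < Order.min R1 R2)%E by rewrite lt_min R1_gt0 R2_gt0.
  case: (Order.min R1 R2) => [s s0| _|//]; last by exists 1; rewrite ?ltry.
  exists (s / 2); first by rewrite divr_gt0.
  by rewrite lte_fin ltr_pdivrMr// ltr_pMr// ltr1n.
exists r => // t /andP[t0 tr]; split=> //.
by apply: le_lt_trans rR; rewrite lee_fin.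
Qed.

(** Comparison with the series h, which converges on [D]. Since b_k <= b_k^2, this covers g; it also
    covers the second moments of unbiased estimators of zero. *)
Lemma Pfg_normed_cvg (c : nat -> R) C t : D t ->
  (forall k, `|c k| <= C * (b k ^+ 2 * a k)) ->
  cvgn [normed series (fun k => c k * t ^+ k)].
Proof.
move=> [t0]; rewrite lt_min => /andP[_ tR2] cC.
have ch := cvg_pseries_lt_radius t0 tR2.
have cCh : cvgn (series (C *: (fun k => b k ^+ 2 * a k * t ^+ k))).
  exact: is_cvg_seriesZ.
have le k : `|c k * t ^+ k| <= C * (b k ^+ 2 * a k * t ^+ k).
  rewrite mulrA normrM (ger0_norm (exprn_ge0 _ (ltW t0))).
  by rewrite ler_wpM2r// exprn_ge0// ltW.
apply: series_le_cvg cCh => k; [exact: normr_ge0| |exact: le].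
exact: (le_trans (normr_ge0 _) (le k)).
Qed.

Lemma Pfg_normed_cvg_gZ x t : D t ->
  cvgn [normed series (fun k => x * (b k * a k) * t ^+ k)].
Proof.
move=> Dt; apply: (@Pfg_normed_cvg _ `|x| _ Dt) => k; have bk := b_ge1 k.
rewrite normrM ler_wpM2l// ger0_norm.
  by rewrite ler_pM2r// expr2 ler_peMl// (le_trans ler01).
by rewrite mulr_ge0 ?(ltW (a_gt0 k))// (le_trans ler01).
Qed.

Lemma Pfg_cvg_g t : D t -> cvgn (pseries (fun k => b k * a k) t).
Proof.
move=> /(@Pfg_normed_cvg_gZ 1)/normed_cvg.
by under eq_fun do rewrite mul1r.
Qed.

Lemma Pfg_g_gt0 t : D t -> 0 < g t.
Proof.
move=> Dt; have [t0 _] := Dt; have bk k : 0 < b k * a k * t ^+ k.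
  by rewrite !mulr_gt0 ?exprn_gt0//; apply: lt_le_trans (b_ge1 k).
apply: (@lt_le_trans _ _ (pseries (fun k => b k * a k) t 1)).
  by rewrite /pseries/= seriesEnat/= big_nat1.
apply: nondecreasing_cvgn_le (Pfg_cvg_g Dt) _.
by apply: nondecreasing_series => k _ _; exact: ltW (bk k).
Qed.

Lemma Pfg_Some t k : D t -> P t [set Some k] = (a k * t ^+ k / g t)%:E.
Proof.
by move=> [t0]; rewrite lt_min => /andP[t1 t2]; rewrite [LHS]Pfg1.
Qed.

Lemma integrable_PfgP X t : D t ->
  (P t).-integrable setT (EFin \o X) <->
  cvgn [normed series (fun k => (X (Some k) - X None) * a k * t ^+ k)].
Proof.
move=> Dt; have g0 := Pfg_g_gt0 Dt; rewrite integrable_outcomeP.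
have -> : [normed series (fun k =>
      (X (Some k) - X None) * fine (P t [set Some k]))] =
    series ((g t)^-1 *:
      (fun k => `|(X (Some k) - X None) * a k * t ^+ k|)).
  congr series; apply/funext => k /=; rewrite Pfg_Some//= !mulrA normrM.
  by rewrite mulrC gtr0_norm ?invr_gt0.
by rewrite seriesZ is_cvgZlE// invr_neq0// gt_eqF.
Qed.

Lemma expectation_Pfg X t : D t -> (P t).-integrable setT (EFin \o X) ->
  'E_(P t)[X]%E =
  (X None + powser (fun k => (X (Some k) - X None) * a k) t / g t)%:E.
Proof.
move=> Dt iX; rewrite expectation_outcome//; congr (_ + _)%:E.
rewrite mulrC; have cu := normed_cvg ((integrable_PfgP X Dt).1 iX).
apply: (etrans _ (lim_seriesZ (g t)^-1 cu)).
congr (limn (series _)); apply/funext => k /=.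
by rewrite Pfg_Some//= -[RHS]/((g t)^-1 * _) !mulrA mulrC !mulrA.
Qed.

(** * Unbiased estimators of zero *)

Lemma unbiased_zero_coef X : (0 < R1)%E -> (0 < R2)%E ->
  unbiased D P (fun=> 0) X ->
  forall k, X (Some k) = - X None * (b k - 1).
Proof.
move=> R1_gt0 R2_gt0 uX k; have [r r0 rD] := Pfg_domain_itv R1_gt0 R2_gt0.
(* [c] holds the coefficients in the expectation formula and [d] those of X(-1) g; multiplying E_t X
   = 0 by g(t) says that the two series add up to zero. *)
pose c k := (X (Some k) - X None) * a k.
pose d k := X None * (b k * a k).
suff /(_ k) : forall k, c k + d k = 0.
  rewrite /c /d mulrA -mulrDl => /eqP; rewrite mulf_eq0 (gt_eqF (a_gt0 k)) orbF.
  rewrite -addrA addr_eq0 => /eqP ->; ring.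
apply: powser_eq0 r0 _ => t /rD Dt.
have [iX EX] := uX _ Dt; have cc := (integrable_PfgP X Dt).1 iX.
have g0 := Pfg_g_gt0 Dt.
have dE : (fun k => d k * t ^+ k) = X None *: (fun k => b k * a k * t ^+ k).
  by apply/funext => j; rewrite /d -mulrA.
have cd : cvgn [normed series (fun k => d k * t ^+ k)].
  exact: Pfg_normed_cvg_gZ.
have cdE : (fun k => (c k + d k) * t ^+ k) =
    (fun k => c k * t ^+ k) + (fun k => d k * t ^+ k).
  by apply/funext => j; rewrite mulrDl.
split.
  rewrite cdE; apply: series_le_cvg (is_cvg_seriesD cc cd) => j /=.
  - exact: normr_ge0.
  - exact: addr_ge0.
  - exact: ler_normD.
rewrite /powser /pseries cdE lim_seriesD; [|exact: normed_cvg..].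
rewrite dE lim_seriesZ; last exact: Pfg_cvg_g.
move: EX; rewrite expectation_Pfg// => -[] /(congr1 ( *%R^~ (g t))).
by rewrite mul0r mulrDl divfK ?gt_eqF// addrC.
Qed.

(** The relation turns X(k) - X(-1) into -X(-1) b_k, so the series in the expectation is -X(-1) g(t)
    and cancels X(-1) after division by g(t). *)
Lemma zero_coef_unbiased X :
  (forall k, X (Some k) = - X None * (b k - 1)) ->
  unbiased D P (fun=> 0) X /\ finite_second_moment D P X.
Proof.
move=> XE; have XB k : (X (Some k) - X None) * a k = - X None * (b k * a k).
  by rewrite XE; ring.
split=> t Dt.
  have iX : (P t).-integrable setT (EFin \o X).
    apply/(integrable_PfgP X Dt).
    by under eq_fun do rewrite XB; exact: Pfg_normed_cvg_gZ.
  split=> //; rewrite expectation_Pfg//; congr _%:E.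
  rewrite (_ : powser _ _ = - X None * g t); last first.
    apply: (etrans _ (lim_seriesZ (- X None) (Pfg_cvg_g Dt))).
    congr (limn (series _)); apply/funext => k /=.
    by rewrite XB -mulrA.
  by rewrite mulfK ?subrr// gt_eqF// Pfg_g_gt0.
have /integrableP[_] : (P t).-integrable setT (EFin \o (fun x => X x ^+ 2)).
  apply/(integrable_PfgP (fun x => X x ^+ 2) Dt).
  apply: (@Pfg_normed_cvg _ (X None ^+ 2) _ Dt) => k; have bk := b_ge1 k.
  rewrite XE normrM (gtr0_norm (a_gt0 k)) mulrA ler_pM2r//.
  (* Integrability of the square concerns the increments X(k)^2 - X(-1)^2, here factored so that h
     dominates them. *)
  have -> : (- X None * (b k - 1)) ^+ 2 - X None ^+ 2 =
    X None ^+ 2 * (b k * (b k - 2)) by ring.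
  by rewrite normrM ger0_norm ?sqr_ge0// ler_wpM2l ?sqr_ge0// normM_sub2_le.
rewrite unlock; congr (_ < _)%E; apply: eq_integral => x _ /=.
by rewrite ger0_norm// sqr_ge0.
Qed.

(** * Estimators constant off a finite set, and UMVUEs *)

(** The series of increments reduces to a finite sum. Applied to T it gives the form of [psi] in
    (c); applied to the square of T it gives a finite second moment. *)
Lemma Pfg_finite_support X (J : set nat) t : D t -> finite_set J ->
  (forall k, ~ J k -> X (Some k) = X None) ->
  (P t).-integrable setT (EFin \o X) /\
  'E_(P t)[X]%E =
  (X None + \sum_(k \in J) ((X (Some k) - X None) * a k * t ^+ k / g t))%:E.
Proof.
move=> Dt Jfin XJ; pose u k := (X (Some k) - X None) * a k * t ^+ k.
have u0 k : ~ J k -> u k = 0 by move=> /XJ XkE; rewrite /u XkE subrr !mul0r.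
have iX : (P t).-integrable setT (EFin \o X).
  apply/(integrable_PfgP X Dt)/cvg_ex.
  exists (\sum_(k \in J) `|u k|); apply: cvg_series_finite_support => // k.
  by move=> /u0 uk; apply/eqP; rewrite normr_eq0; apply/eqP.
split=> //; rewrite expectation_Pfg//; congr (_ + _)%:E.
rewrite (_ : powser _ _ = \sum_(k \in J) u k); last first.
  by apply: cvg_lim => //; apply: cvg_series_finite_support.
by rewrite mulrC fsbig_distrr//; apply: eq_fsbigr => k _; rewrite mulrC.
Qed.

Let J := [set k | b k = 1].

Lemma UMVUE_Pfg_coef psi T : (0 < R1)%E -> (0 < R2)%E ->
  UMVUE_finite_variance D P psi T -> forall k, ~ J k -> T (Some k) = T None.
Proof.
move=> R1_gt0 R2_gt0 TU k /eqP bk1; have [T2 _ _] := TU.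
(* The unbiased estimator of zero normalized by X(-1) = -1; it is nonzero at each k with b_k
   different from 1, so it can be cancelled there. *)
pose X x := if x is Some k then b k - 1 else -1.
have [uX X2] : unbiased D P (fun=> 0) X /\ finite_second_moment D P X.
  by apply: zero_coef_unbiased => j; rewrite opprK mul1r.
have uTX : unbiased D P (fun=> 0) (T \* X).
  move=> t Dt.
  have LT := Lfun2_second_moment (@measurable_outcome _ _ T) (T2 _ Dt).
  have LX := Lfun2_second_moment (@measurable_outcome _ _ X) (X2 _ Dt).
  have LTX := Lfun2_mul_Lfun1 LT LX; split; first exact/Lfun1_integrable.
  have Pfin : P t setT \is a fin_num := fin_num_measure (P t) _ measurableT.
  have LT1 := Lfun_subset12 Pfin LT; have LX1 := Lfun_subset12 Pfin LX.
  have := UMVUE_uncorrelated TU uX X2 Dt.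
  by rewrite covarianceE// (uX _ Dt).2 mule0 sube0.
have := unbiased_zero_coef R1_gt0 R2_gt0 uTX k.
by rewrite /X /= mulrN1 opprK; apply: mulIf; rewrite subr_eq0.
Qed.

(** Any competitor is S = T + X with X unbiased for zero. The coefficient formula for X makes its
    second moment finite, hence that of S, and T X is again unbiased for zero. So Cov(T, X) = 0 and
    Var S = Var T + Var X. *)
Lemma UMVUE_Pfg psi T : (0 < R1)%E -> (0 < R2)%E -> finite_set J ->
  (forall k, ~ J k -> T (Some k) = T None) ->
  (forall t, D t -> 'E_(P t)[T]%E = (psi t)%:E) ->
  UMVUE_finite_variance D P psi T.
Proof.
move=> R1_gt0 R2_gt0 Jfin TJ ET.
have iT t : D t -> (P t).-integrable setT (EFin \o T).
  by move=> Dt; have [] := Pfg_finite_support Dt Jfin TJ.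
have T2 : finite_second_moment D P T.
  move=> t Dt.
  have [|_ ->] := Pfg_finite_support (X := fun x => T x ^+ 2) Dt Jfin.
    by move=> k /TJ ->.
  exact: ltry.
split=> // [t Dt|S uS t Dt]; first by split; [exact: iT|exact: ET].
pose X := S \- T.
have SE : S = T \+ X by apply/funext => x; rewrite /X /= addrC subrK.
have XE : forall k, X (Some k) = - X None * (b k - 1).
  apply: unbiased_zero_coef => // s Ds; have [iS ES] := uS _ Ds.
  have S1 : S \in Lfun (P s) 1 by exact/Lfun1_integrable.
  have T1 : T \in Lfun (P s) 1 by exact/Lfun1_integrable/iT.
  split; first exact/Lfun1_integrable/rpredB.
  by rewrite expectationB// ES ET// subee.
have [uX X2] := zero_coef_unbiased XE.
(* On [J] both sides of the coefficient relation for T X vanish; off [J], T equals T(-1), and the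
   relation is that of X multiplied by T(-1). *)
have [uTX _] :
    unbiased D P (fun=> 0) (T \* X) /\ finite_second_moment D P (T \* X).
  apply: zero_coef_unbiased => k /=; rewrite XE.
  have [->|/eqP bk] := eqVneq (b k) 1; first by rewrite subrr !mulr0.
  by rewrite TJ// !mulrA mulrN.
have LT := Lfun2_second_moment (@measurable_outcome _ _ T) (T2 _ Dt).
have LX := Lfun2_second_moment (@measurable_outcome _ _ X) (X2 _ Dt).
have Pfin : P t setT \is a fin_num := fin_num_measure (P t) _ measurableT.
have LT1 := Lfun_subset12 Pfin LT; have LX1 := Lfun_subset12 Pfin LX.
rewrite SE varianceD// covarianceE ?Lfun2_mul_Lfun1// (uTX _ Dt).2 (uX _ Dt).2.
by rewrite mule0 sube0 mule0 adde0 leeDl// variance_ge0.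
Qed.

End Pfg_family.

(** * Deduction of (a), (b) and (c) *)

Theorem theorem1 (R : realType) (a b : nat -> R)
  (a_gt0 : forall k, 0 < a k)
  (R1 : \bar R) (R1E : R1 = radius_of_convergence a) (R1_gt0 : (0 < R1)%E)
  (b_unbounded : ~ bounded_fun b)
  (b0 : b 0%N = 1)
  (b_ge1 : forall k, (1 <= k)%N -> 1 <= b k)
  (J : set nat) (JE : J = [set k | b k = 1]) (J_finite : finite_set J)
  (R2 : \bar R) (R2E : R2 = radius_of_convergence (fun k => b k ^+ 2 * a k))
  (R2_gt0 : (0 < R2)%E)
  (D : set R) (DE : D = [set t : R | 0 < t /\ (t%:E < Order.min R1 R2)%E])
  (g : R -> R) (gE : g = powser (fun k => b k * a k)) :
  [/\ (forall delta : outcome -> R,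
        unbiased D (Pfg a b) (fun=> 0) delta /\
        finite_second_moment D (Pfg a b) delta <->
        forall k : nat, delta (Some k) = - delta None * (b k - 1)),
      ~ complete D (Pfg a b) /\ boundedly_complete D (Pfg a b) &
      (forall psi : R -> R,
        (exists T : outcome -> R, UMVUE_finite_variance D (Pfg a b) psi T) <->
        exists (a' : R) (c : nat -> R), forall t, D t ->
          psi t = a' + \sum_(k \in J) (c k * t ^+ k / g t))].
Proof.
have {b0 b_ge1}b_ge1 k : 1 <= b k by case: k => [|k]; rewrite ?b0// b_ge1.
subst R1 R2 J D g; split=> [X||psi].
- split=> [[uX _]|]; first exact: unbiased_zero_coef.
  exact: zero_coef_unbiased.
- split=> [cP|X [M [_ Xbd]] uX t Dt].
    (* If every b_k were 1, then [b] would be bounded. *)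
    have [k bk1] : exists k, b k != 1.
      apply: contrapT => /forallNP b1; apply: b_unbounded.
      exists 1; split=> // M M1 k _ /=; have /negP/negPn/eqP -> := b1 k.
      by rewrite normr1 ltW.
    pose X (x : outcome) := if x is Some k then b k - 1 else -1.
    have XE j : X (Some j) = - X None * (b j - 1) by rewrite opprK mul1r.
    have [uX _] := zero_coef_unbiased a_gt0 b_ge1 XE.
    have [t t0 tD] := Pfg_domain_itv R1_gt0 R2_gt0.
    have {tD}Dt := tD t; rewrite t0 lexx in Dt; have {}Dt := Dt isT.
    (* Completeness would make the complement of {X = 0} null, yet it contains the atom k of
       positive mass. *)
    have : (Pfg a b t [set Some k] <= Pfg a b t (~` [set x | X x = 0%R]))%E.
      apply: le_measure; rewrite ?inE// => _ ->/=.
      by apply/eqP; rewrite subr_eq0.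
    rewrite probability_setC// cP// subee// Pfg_Some// lee_fin leNgt.
    by rewrite divr_gt0 ?mulr_gt0 ?exprn_gt0// Pfg_g_gt0.
  have XE := unbiased_zero_coef a_gt0 b_ge1 R1_gt0 R2_gt0 uX.
  suff XN : X None = 0.
    rewrite (_ : [set x | X x = 0] = setT) ?probability_setT//.
    by apply/seteqP; split=> // -[k|] _ //=; rewrite XE XN oppr0 mul0r.
  apply/eqP/negPn/negP => XN; apply: b_unbounded.
  (* From |b_k - 1| = |X(k)| / |X(-1)|. The bound on X is available only for constants strictly
     above [M], hence [M + 1]. *)
  exists (1 + (M + 1) / `|X None|); split=> [|N MN k _ /=].
    exact: num_real.
  apply: (le_trans _ (ltW MN)).
  rewrite -[X in `|X|](subrK 1) addrC.
  apply: (le_trans (ler_normD _ _)); rewrite normr1 lerD2l.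
  rewrite ler_pdivlMr ?normr_gt0// mulrC -normrN -normrM.
  by rewrite mulrN -mulNr -XE; apply: Xbd => //; rewrite ltrDl.
- split=> [[T TU]|[a' [c psiE]]].
    have TJ := UMVUE_Pfg_coef a_gt0 b_ge1 R1_gt0 R2_gt0 TU.
    (* Read off from the expectation of an estimator constant off [J]. *)
    exists (T None), (fun k => (T (Some k) - T None) * a k) => t Dt.
    have [_ uT _] := TU; have [_ ET] := uT _ Dt.
    have [_] := Pfg_finite_support a_gt0 b_ge1 Dt J_finite TJ.
    by rewrite ET => -[].
  (* Inverts the previous choice of constants: on [J] the increment c_k / a_k contributes c_k t^k /
     g(t) to the expectation. *)
  pose T (x : outcome) :=
    if x is Some k then if b k == 1 then a' + c k / a k else a' else a'.
  have TJ k : ~ [set k | b k = 1] k -> T (Some k) = T None.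
    by move=> /eqP/negPf /= ->.
  exists T; apply: UMVUE_Pfg => // t Dt.
  have [_ ->] := Pfg_finite_support a_gt0 b_ge1 Dt J_finite TJ.
  rewrite psiE//; congr (_ + _)%:E; apply: eq_fsbigr => k; rewrite inE /= => ->.
  by rewrite eqxx addrAC subrr add0r divfK// gt_eqF.
Qed.
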